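(* Let $q$ be a prime power, $k\ge 2$ and $r\ge 1$ integers. Then there exists an integer $D$ (depending on $q$, $k$, $r$) such that for all integers $d\ge D$ we have $n_q(k,d,r)=g_q(k,d)$.
   Context: An $[n,k,d]_q$-code is a $k$-dimensional subspace of $\mathbb{F}_q^n$ with minimum Hamming distance at least $d$. A linear code $C\subseteq\mathbb{F}_q^n$ has locality $r$ if for every coordinate $i\in\{1,\dots,n\}$ there is a set $S_i\subseteq\{1,\dots,n\}$ with $i\notin S_i$, $|S_i|\le r$, such that any two codewords $c,c'\in C$ with $c_j=c'_j$ for all $j\in S_i$ satisfy $c_i=c'_i$. $n_q(k,d,r)$ denotes the minimum length $n$ of an $[n,k,d]_q$-code with locality $r$. $g_q(k,d)=\sum_{i=0}^{k-1}\lceil d/q^i\rceil$ is the Griesmer bound. *)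

(* Defs.v *)
From mathcomp Require Import all_boot all_order all_algebra all_field.

Set Implicit Arguments.
Unset Strict Implicit.
Unset Printing Implicit Defensive.

Definition prime_power (q : nat) : Prop :=
  exists p m : nat, [/\ prime p, 0 < m & q = p ^ m].

Definition hamming_dist (F : finFieldType) (n : nat) (x y : 'rV[F]_n) : nat :=
  #|[set i : 'I_n | x ord0 i != y ord0 i]|.

Definition is_linear_code (F : finFieldType) (n k d : nat)
    (C : {vspace 'rV[F]_n}) : Prop :=
  \dim C = k /\
  (forall x y, x \in C -> y \in C -> x != y -> d <= hamming_dist x y).

Definition has_locality (F : finFieldType) (n : nat)
    (C : {vspace 'rV[F]_n}) (r : nat) : Prop :=
  forall i : 'I_n, exists S : {set 'I_n},
    [/\ i \notin S, #|S| <= r &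
        forall x y, x \in C -> y \in C ->
          (forall j, j \in S -> x ord0 j = y ord0 j) -> x ord0 i = y ord0 i].

Definition lrc_exists (F : finFieldType) (n k d r : nat) : Prop :=
  exists C : {vspace 'rV[F]_n}, is_linear_code k d C /\ has_locality C r.

(* The relation "n = n_q(k,d,r)" with q = #|F|: the minimum length is attained
   at n. The field of order q is unique up to isomorphism. *)
Definition is_min_lrc_length (F : finFieldType) (k d r n : nat) : Prop :=
  lrc_exists F n k d r /\ (forall m, lrc_exists F m k d r -> n <= m).

(* The ceiling of m / n, for n > 0. *)
Definition ceil_divn (m n : nat) : nat := (m + n.-1) %/ n.

Lemma ceil_divn_leq (m n c : nat) : 0 < n -> (ceil_divn m n <= c) = (m <= c * n).
Proof.
case: n => // n _; rewrite /ceil_divn -ltnS ltn_divLR // mulSn /=.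
by rewrite [n.+1 + _]addnC addnS ltnS leq_add2r.
Qed.

Definition griesmer (q k d : nat) : nat := \sum_(i < k) ceil_divn d (q ^ i).

(* Main.v *)
Require Import Defs.
From mathcomp Require Import all_boot all_order all_algebra all_field.
From mathcomp Require Import zify.

(** Lower bound: if [c] is a word of minimum weight [w] in [C], restricting a
complement of [<c>] in [C] to the zero coordinates of [c] gives a code of
dimension [k-1] and minimum distance at least [w/q], so the Griesmer bound
follows by induction on [k].

Construction: given a code of length [n'] attaining the bound for [k-1] and
[ceil(d/q)], replace each column [v] of its generator matrix by the [q] columns
[(x, v)], with [x] in [F], and add [m = d - (q-1) n'] copies of [(1, 0)].  The
new length is [q n' + m = d + n'], which is the Griesmer bound for [k] and [d].
A message [(a, u)] with [a <> 0] has weight [(q-1) n' + m = d], and [(0, u)] has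
[q] times the weight of [u].  For [d] large, [m >= 2] at every step, so every
column is repeated and the code has locality 1. *)

Set Implicit Arguments.
Unset Strict Implicit.
Unset Printing Implicit Defensive.

Import GRing.Theory.

(** * Arithmetic of ceilings and of the Griesmer sum *)

Lemma ceil_divn1 d : ceil_divn d 1 = d.
Proof. by rewrite /ceil_divn addn0 divn1. Qed.

Lemma leq_ceil_divn_mul d n : 0 < n -> d <= ceil_divn d n * n.
Proof. by move=> n_gt0; rewrite -ceil_divn_leq. Qed.

Lemma ceil_divn_mul_lt d n : 0 < n -> ceil_divn d n * n < d + n.
Proof.
move=> n_gt0; apply: leq_ltn_trans (leq_divM _ _) _.
by rewrite ltn_add2l prednK.
Qed.

Lemma ceil_divn_mono n : 0 < n -> {homo ceil_divn^~ n : d e / d <= e}.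
Proof. by move=> n_gt0 d e le_de; apply: leq_div2r; rewrite leq_add2r. Qed.

Lemma ceil_divnMA d m n : 0 < m -> 0 < n ->
  ceil_divn (ceil_divn d m) n = ceil_divn d (m * n).
Proof.
move=> m_gt0 n_gt0; apply/eqP; rewrite eqn_leq ceil_divn_leq // ceil_divn_leq //.
rewrite ceil_divn_leq ?muln_gt0 ?m_gt0 //.
rewrite -mulnA [n * m]mulnC leq_ceil_divn_mul ?muln_gt0 ?m_gt0 //=.
by rewrite mulnCA mulnC -ceil_divn_leq // leq_ceil_divn_mul.
Qed.

Lemma griesmerS q k d : 0 < q ->
  griesmer q k.+1 d = d + griesmer q k (ceil_divn d q).
Proof.
move=> q_gt0; rewrite /griesmer big_ord_recl expn0 ceil_divn1; congr (_ + _).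
by apply: eq_bigr => i _; rewrite ceil_divnMA ?expn_gt0 ?q_gt0 // lift0 expnS.
Qed.

Lemma griesmer_mono q k : 0 < q -> {homo griesmer q k : d e / d <= e}.
Proof.
move=> q_gt0 d e le_de; apply: leq_sum => i _.
by apply: ceil_divn_mono; rewrite ?expn_gt0 ?q_gt0.
Qed.

(** Each rounding up costs less than [q], and the [k] inequalities telescope. With [n'] the Griesmer
    sum for [ceil(d/q)], this gives [d - (q-1) n' >= ceil(d/q^k) - k q], the room for extra columns
    in the construction. *)
Lemma griesmer_mul_bound q k d : 0 < q ->
  q * griesmer q k (ceil_divn d q) + ceil_divn d (q ^ k)
    <= d + griesmer q k (ceil_divn d q) + k * q.
Proof.
move=> q_gt0; elim: k d => [|k IHk] d.
  by rewrite /griesmer !big_ord0 expn0 ceil_divn1 muln0 !addn0.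
have := IHk (ceil_divn d q).
rewrite griesmerS // expnS -ceil_divnMA ?expn_gt0 ?q_gt0 //.
have := ceil_divn_mul_lt d q_gt0.
rewrite mulnDr mulSn [q * ceil_divn d q]mulnC; lia.
Qed.

Lemma sum_affine_neq0 (F : finFieldType) (a b : F) : a != 0%R ->
  \sum_(x : F) ((x * a + b)%R != 0%R) = #|F|.-1.
Proof.
move=> a_neq0; rewrite -(cardC1 (- b / a)%R) -sum1_card [RHS]big_mkcond.
apply: eq_bigr => x _.
by rewrite !inE addr_eq0 -[x == _](inj_eq (mulIf a_neq0)) divfK.
Qed.

(** * The Griesmer lower bound *)

Section GriesmerBound.

Variables (F : finFieldType) (n : nat).
Implicit Types (x c : 'rV[F]_n) (S : {set 'I_n}) (C : {vspace 'rV[F]_n}).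

Definition weight_on S x : nat := \sum_(i in S) (x ord0 i != 0%R).

Definition zeros_in S c : {set 'I_n} := [set i in S | c ord0 i == 0%R].

Lemma sum_zeros_in S c (f : 'I_n -> nat) :
  \sum_(i in zeros_in S c) f i = \sum_(i in S) (c ord0 i == 0%R) * f i.
Proof.
under eq_bigl do rewrite inE.
by rewrite big_mkcondr; apply: eq_bigr => i _; case: eqP; rewrite ?mul1n ?mul0n.
Qed.

Lemma card_zeros_in S c : #|S| = weight_on S c + #|zeros_in S c|.
Proof.
rewrite /weight_on -!sum1_card sum_zeros_in -big_split /=.
by apply: eq_bigr => i _; case: eqP.
Qed.

(** Where [c] vanishes, all [q] words of the line agree with [x]; at any other coordinate exactly
    one scalar [a] gives zero. *)
Lemma sum_weight_line S x c :
  \sum_(a : F) weight_on S (a *: c + x)%R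
    = #|F| * weight_on (zeros_in S c) x + #|F|.-1 * weight_on S c.
Proof.
rewrite {2}/weight_on sum_zeros_in /weight_on exchange_big !big_distrr -big_split /=.
apply: eq_bigr => i _; under eq_bigr do rewrite !mxE.
have [->|ci_neq0] := eqVneq (c ord0 i) 0%R; last first.
  by rewrite sum_affine_neq0 // mul0n muln0 muln1.
under eq_bigr do rewrite mulr0 add0r.
by rewrite sum_nat_const mul1n muln0 addn0.
Qed.

(** Weights are measured on a set [S] of coordinates so that the induction can shrink [S] while the
    ambient space stays fixed. *)
Lemma griesmer_bound C S d :
  (forall x, x \in C -> x != 0%R -> d <= weight_on S x) ->
  griesmer #|F| (\dim C) d <= #|S|.
Proof.
have q_gt1 : 1 < #|F| := finNzRing_gt1 F.
have q_gt0 : 0 < #|F| := ltnW q_gt1.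
move dimC : (\dim C) => k; elim: k => [|k IHk] in C S d dimC *.
  by rewrite /griesmer big_ord0.
move=> wtC; have C_neq0 : C != 0%VS by rewrite -dimv_eq0 dimC.
have x0P : (vpick C \in C) && (vpick C != 0%R) by rewrite memv_pick vpick0.
pose P x := (x \in C) && (x != 0%R).
have [c /andP[cC c_neq0] minc] := @arg_minnP _ (vpick C) P (weight_on S) x0P.
rewrite (card_zeros_in S c).
apply: leq_trans (griesmer_mono k.+1 q_gt0 (wtC c cC c_neq0)) _.
rewrite griesmerS // leq_add2l.
have sub_cC : (<[c]> <= C)%VS by rewrite -memvE.
apply: (IHk (C :\: <[c]>)%VS) => [|x xC' x_neq0].
  have := dimv_cap_compl C <[c]>%VS.
  by rewrite (capv_idPr sub_cC) dim_vline c_neq0 dimC => -[].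
rewrite ceil_divn_leq //.
(* Since [x] is a nonzero element of a complement of [<c>], no word [a *: c + x] is zero, and
   minimality of [c] applies. *)
have le_line a : weight_on S c <= weight_on S (a *: c + x)%R.
  apply: minc; apply/andP; split.
    by rewrite memvD ?memvZ // (subvP (diffvSl _ _) _ xC').
  apply: contraNneq x_neq0 => /eqP; rewrite addrC addr_eq0 => /eqP x_eq.
  rewrite -memv0 -(capv_diff C <[c]>%VS) memv_cap xC' x_eq.
  by rewrite memvN memvZ // memv_line.
(* Summing over the line and cancelling [(q-1)] times the weight of [c] leaves that weight at most
   [q] times the weight of [x] on the zeros of [c]. *)
have : #|F| * weight_on S c <= \sum_(a : F) weight_on S (a *: c + x)%R.
  by rewrite -sum_nat_const; apply: leq_sum => a _; apply: le_line.
rewrite sum_weight_line -{1}(prednK q_gt0) mulSn leq_add2r.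
by rewrite mulnC.
Qed.

End GriesmerBound.

Lemma code_length_griesmer (F : finFieldType) (n k d : nat)
    (C : {vspace 'rV[F]_n}) : is_linear_code k d C -> griesmer #|F| k d <= n.
Proof.
case=> <- distC; rewrite -[leqRHS]card_ord -[leqRHS]cardsT.
apply: griesmer_bound => x xC x_neq0.
apply: leq_trans (distC x 0%R xC (mem0v _) x_neq0) _.
rewrite /hamming_dist /weight_on -sum1_card big_mkcond [X in _ <= X]big_mkcond.
by apply: leq_sum => i _; rewrite !inE mxE; case: eqP.
Qed.

(** * Codes attaining the bound with repeated columns *)

Section Construction.

Variable F : finFieldType.

Definition entry k (u : 'rV[F]_k) (v : 'cV[F]_k) : F := (u *m v)%R ord0 ord0.

Lemma entry_col_mx k (a : F) (u : 'rV[F]_k) (b : F) (v : 'cV[F]_k) :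
  entry (row_mx a%:M u : 'rV_(1 + k)) (col_mx b%:M v) = (b * a + entry u v)%R.
Proof.
by rewrite /entry mul_row_col mul_scalar_mx !mxE mulr1n mulrC.
Qed.

Definition extend_columns k (I : finType) (G : I -> 'cV[F]_k) m
    (s : F * I + 'I_m) : 'cV[F]_(1 + k) :=
  match s with
  | inl xi => col_mx (xi.1)%:M (G xi.2)
  | inr _ => col_mx 1%:M 0%R
  end.

Lemma extend_columns_weight k (I : finType) (G : I -> 'cV[F]_k) m
    (a : F) (u : 'rV[F]_k) :
  \sum_s (entry (row_mx a%:M u : 'rV_(1 + k)) (@extend_columns k I G m s) != 0%R)
    = if a == 0%R then #|F| * \sum_i (entry u (G i) != 0%R)
      else #|F|.-1 * #|I| + m.
Proof.
rewrite big_sumType /= -(pair_bigA _ (fun x i => nat_of_bool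
  (entry (row_mx a%:M u : 'rV_(1 + k)) (col_mx x%:M (G i)) != 0%R))) /=.
rewrite exchange_big /=.
under eq_bigr => i _ do under eq_bigr => x _ do rewrite entry_col_mx.
under [X in _ + X]eq_bigr => s _.
  rewrite entry_col_mx /entry mulmx0 mxE addr0 mul1r; over.
rewrite sum_nat_const card_ord.
have [->|a_neq0] := eqVneq a 0%R.
  rewrite muln0 addn0 big_distrr; apply: eq_bigr => i _.
  by under eq_bigr do rewrite mulr0 add0r; rewrite sum_nat_const.
rewrite muln1; congr (_ + _).
under eq_bigr do rewrite sum_affine_neq0 //.
by rewrite sum_nat_const mulnC.
Qed.

(* [k * q + 2 <= ceil(d / q^k)] keeps all the multiplicities [m] at least 2. *)
Lemma griesmer_columns k d : k * #|F| + 2 <= ceil_divn d (#|F| ^ k) ->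
  exists (I : finType) (G : I -> 'cV[F]_k),
    [/\ #|I| = griesmer #|F| k d,
        forall u, u != 0%R -> d <= \sum_i (entry u (G i) != 0%R)
      & forall i, exists2 j, j != i & G j = G i].
Proof.
have q_gt1 : 1 < #|F| := finNzRing_gt1 F.
have q_gt0 : 0 < #|F| := ltnW q_gt1.
elim: k d => [|k IHk] d d_large.
  exists void, (fun _ => 0%R); split=> [|u|[]].
    by rewrite card_void /griesmer big_ord0.
  by rewrite thinmx0 eqxx.
have d_large' : k * #|F| + 2 <= ceil_divn (ceil_divn d #|F|) (#|F| ^ k).
  by rewrite ceil_divnMA ?expn_gt0 ?q_gt0 // -expnS; lia.
have [I [G [cardI wtG dupG]]] := IHk _ d_large'.
have le_len : #|F|.-1 * #|I| + 2 <= d.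
  have := griesmer_mul_bound k d q_gt0; rewrite -cardI => bound.
  (* The bound [k q + 2] passes from [ceil(d/q)] to [d] by monotonicity; its [k q] absorbs the
     rounding error in [bound] and its 2 remains. *)
  have := ceil_divn_mono (n := #|F| ^ k) _ (_ : ceil_divn d #|F| <= d).
  rewrite expn_gt0 q_gt0 ceil_divn_leq // leq_pmulr // => /(_ isT isT) mono.
  have := leq_trans d_large' mono => large.
  have eqF : #|F| * #|I| = #|F|.-1 * #|I| + #|I|.
    by rewrite -{1}(prednK q_gt0) mulSn addnC.
  lia.
pose m := d - #|F|.-1 * #|I|.
have m_gt1 : 1 < m by rewrite /m; lia.
exists (F * I + 'I_m)%type, (@extend_columns k I G m); split.
- rewrite card_sum card_prod card_ord griesmerS // -cardI.
  rewrite -{1}(prednK q_gt0) mulSn /m; lia.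
- move=> u u_neq0; rewrite -[u](@hsubmxK _ 1 1 k) [lsubmx _]mx11_scalar in u_neq0 *.
  move: (lsubmx _ _ _) (rsubmx _) u_neq0 => a v av_neq0.
  rewrite extend_columns_weight; have [a0|_] := eqVneq; last by rewrite /m; lia.
  apply: leq_trans (leq_ceil_divn_mul d q_gt0) _; rewrite mulnC leq_mul2l wtG ?orbT //.
  by apply: contraNneq av_neq0 => ->; rewrite a0 raddf0 row_mx0.
(* A column [(x, v)] inherits its duplicate from [v]; the column [(1, 0)] has [m >= 2] copies. *)
- case=> [[x i]|s].
    have [j j_neq_i Gj] := dupG i; exists (inl (x, j)); last by rewrite /= Gj.
    by apply: contraNneq j_neq_i => -[->].
  have [t t_neq_s] : exists t : 'I_m, t != s.
    apply/existsP; rewrite -negb_forall; apply: contraTN m_gt1 => /forallP all_s.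
    rewrite -leqNgt -[m]card_ord -(card1 s) subset_leq_card //.
    by apply/subsetP => t _; rewrite inE.
  by exists (inr t) => //; apply: contraNneq t_neq_s => -[->].
Qed.

(** Equal columns give equal coordinates in every codeword, so a single other coordinate recovers
    each one. *)
Lemma columns_code k d r (I : finType) (G : I -> 'cV[F]_k) :
  0 < d -> 0 < r ->
  (forall u, u != 0%R -> d <= \sum_i (entry u (G i) != 0%R)) ->
  (forall i, exists2 j, j != i & G j = G i) ->
  lrc_exists F #|I| k d r.
Proof.
move=> d_gt0 r_gt0 wtG dupG.
pose M : 'M[F]_(k, #|I|) := (\matrix_(a, j) G (enum_val j) a ord0)%R.
have entryM u j : (u *m M)%R ord0 j = entry u (G (enum_val j)).
  by rewrite /entry !mxE; apply: eq_bigr => a _; rewrite !mxE.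
have distM (u w : 'rV[F]_k) : u != w -> d <= hamming_dist (u *m M)%R (w *m M)%R.
  rewrite -subr_eq0 => /wtG /leq_trans -> //.
  rewrite /hamming_dist -sum1_card.
  rewrite [leqLHS](reindex (fun j : 'I_#|I| => enum_val j)) /=; last first.
    exact/onW_bij/enum_val_bij.
  rewrite [X in _ <= X]big_mkcond; apply: leq_sum => j _.
  by rewrite inE -entryM mulmxBl !mxE subr_eq0; case: eqP.
pose f : 'Hom('rV[F]_k, 'rV[F]_#|I|) := linfun (mulmxr M); exists (limg f).
have fE u : f u = (u *m M)%R by rewrite lfunE.
split; first split.
(* The encoding is injective: a nonzero message in the kernel would have weight 0, against
   [0 < d]. *)
- rewrite limg_dim_eq ?dimvf ?/dim /= ?mul1n //.
  apply/eqP; rewrite -subv0; apply/subvP => u; rewrite memv_cap memv0 memv_ker fE.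
  case/andP => _ /eqP uM0; apply/negPn/negP => /distM.
  rewrite uM0 mul0mx leqNgt => /negP; apply; apply: leq_trans d_gt0.
  by rewrite ltnS leqn0 cards_eq0; apply/eqP/setP => j; rewrite !inE eqxx.
- move=> _ _ /memv_imgP[u _ ->] /memv_imgP[w _ ->]; rewrite !fE => uw.
  by apply: distM; apply: contraNneq uw => ->.
- move=> i; have [j j_neq_i Gj] := dupG (enum_val i).
  exists [set enum_rank j]; split.
  + by rewrite inE; apply: contraNneq j_neq_i => ->; rewrite enum_rankK.
  + by rewrite cards1.
  + move=> _ _ /memv_imgP[u _ ->] /memv_imgP[w _ ->] /(_ _ (set11 _)).
    by rewrite !fE !entryM enum_rankK Gj.
Qed.

End Construction.

Theorem theorem10 (q k r : nat) (hq : prime_power q) (hk : 2 <= k)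
    (hr : 1 <= r) :
  exists D : nat, forall d : nat, D <= d ->
    forall F : finFieldType, #|F| = q ->
      is_min_lrc_length F k d r (griesmer q k d).
Proof.
(* This threshold forces [ceil(d/q^k) >= k q + 2], as [griesmer_columns] requires. *)
exists ((k * q + 2) * q ^ k) => d d_ge F cardF; subst q.
have qk_gt0 : 0 < #|F| ^ k by rewrite expn_gt0 (ltnW (finNzRing_gt1 F)).
split=> [|m [C [codeC _]]]; last exact: code_length_griesmer codeC.
have d_large : k * #|F| + 2 <= ceil_divn d (#|F| ^ k).
  by rewrite -(leq_pmul2r qk_gt0) (leq_trans d_ge) // leq_ceil_divn_mul.
have [I [G [<- wtG dupG]]] := griesmer_columns d_large.
apply: (columns_code (G := G)) => //.
by apply: leq_trans d_ge; rewrite muln_gt0 qk_gt0 addn_gt0 orbT.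
Qed.
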